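(* Let $H$ be an infinite dimensional separable complex Hilbert space and let $T\in\mathcal{B}(H)$ be a bounded linear operator such that $\dim N(T)=\dim N(T^* )$. Then $m(T)=m(T^* )$.
   Context: $\mathcal{B}(H)$ is the algebra of bounded linear operators on $H$, $N(T)$ is the kernel of $T$, and $T^*$ is the adjoint. The minimum modulus of $T$ is $m(T)=\inf\{\|Tx\|: x\in H,\ \|x\|=1\}$. *)

(* Defs.v *)
From HB Require Import structures.
From mathcomp Require Import all_boot all_order all_algebra.
From mathcomp Require Import all_classical all_reals all_analysis.
From mathcomp.real_closed Require Import complex.

Set Implicit Arguments.
Unset Strict Implicit.
Unset Printing Implicit Defensive.

Import Order.TTheory GRing.Theory Num.Theory.
Import numFieldNormedType.Exports.

Local Open Scope classical_set_scope.
Local Open Scope ring_scope.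
Local Open Scope complex_scope.

Definition lin_span (K : numFieldType) (V : lmodType K) (E : set V) : set V :=
  [set x | exists (n : nat) (c : 'I_n -> K) (e : 'I_n -> V),
     (forall i, E (e i)) /\ x = \sum_(i < n) c i *: e i].

Definition infinite_dimensional (K : numFieldType) (V : lmodType K) : Prop :=
  ~ exists2 E : set V, finite_set E & lin_span E = setT.

Definition separable_space (X : topologicalType) : Prop :=
  exists2 A : set X, countable A & dense A.

(* The inner product [ip : {dot H for conjC}] is linear in its first argument
   and conjugate-linear in its second one; this says that it induces the norm
   of [H]. *)
Definition induces_norm (R : realType) (H : normedModType R[i])
    (ip : {dot H for @Num.conj R[i]}) : Prop :=
  forall x : H, ip x x = `|x| ^+ 2.

Definition bounded_operator (K : numFieldType) (V : normedModType K)
    (T : V -> V) : Prop :=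
  exists M : K, forall x : V, `|T x| <= M * `|x|.

(* For bounded linear [T] on a Hilbert space, Riesz' theorem provides, for
   every [y], exactly one [z] such that <T x, y> = <x, z> for all [x]; the
   default value 0 is then never used. *)
Definition adjoint (R : realType) (H : normedModType R[i])
    (ip : {dot H for @Num.conj R[i]}) (T : H -> H) (y : H) : H :=
  xget 0 [set z : H | forall x : H, ip (T x) y = ip x z].

Definition null_space (K : numFieldType) (V : normedModType K) (T : V -> V) :
    set V :=
  T @^-1` [set 0].

Definition orthonormal_set (R : realType) (H : normedModType R[i])
    (ip : {dot H for @Num.conj R[i]}) (E : set H) : Prop :=
  forall e f : H, E e -> E f -> ip e f = (e == f)%:R.

(* Orthonormal bases in the Hilbert space sense, of a closed subspace [M]. *)
Definition orthonormal_basis (R : realType) (H : normedModType R[i])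
    (ip : {dot H for @Num.conj R[i]}) (M E : set H) : Prop :=
  orthonormal_set ip E /\ closure (lin_span E) = M.

(* dim M = dim N for closed subspaces, where the dimension is the cardinality
   of an orthonormal basis (it does not depend on the basis). *)
Definition same_dim (R : realType) (H : normedModType R[i])
    (ip : {dot H for @Num.conj R[i]}) (M N : set H) : Prop :=
  exists E F : set H,
    [/\ orthonormal_basis ip M E, orthonormal_basis ip N F & (E #= F)%card].

(* Norms on [H] take their values in [R[i]], hence the real part. *)
Definition min_modulus (R : realType) (H : normedModType R[i])
    (T : H -> H) : R :=
  inf [set complex.Re `|T x| | x in [set x : H | `|x| = 1]].

(* Main.v *)
(* If one of [T], [T*] has a nonzero kernel vector, then so has the other, by
   equality of dimensions, and both minimum moduli are 0. Otherwise both have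
   dense range, and by symmetry it suffices that a lower bound c |x| <= |T x|
   passes to the adjoint. Approximating a unit vector [y] by vectors [T x],
   the number c |<T x, y>| = c |<x, T* y>| <= |T x| |T* y| gives in the limit
   c <= |T* y|. *)
Require Import Defs.
From HB Require Import structures.
From mathcomp Require Import all_boot all_order all_algebra.
From mathcomp Require Import all_classical all_reals all_analysis.
From mathcomp.real_closed Require Import complex.
From mathcomp Require Import ring.

Import Order.TTheory GRing.Theory Num.Theory.
Import numFieldNormedType.Exports.

Local Open Scope classical_set_scope.
Local Open Scope ring_scope.
Local Open Scope complex_scope.

Lemma Re_normK (R : realType) (V : normedModType R[i]) (x : V) :
  (complex.Re `|x|)%:C = `|x|.
Proof. by rewrite RRe_real// normr_real. Qed.

Lemma Re_norm_ge0 (R : realType) (V : normedModType R[i]) (x : V) :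
  0 <= complex.Re `|x|.
Proof. by rewrite -lecR Re_normK; exact: normr_ge0. Qed.

Section Hilbert.
Variables (R : realType) (H : completeNormedModType R[i]).
Variables (ip : {dot H for @Num.conj R[i]}) (H_norm : induces_norm ip).

(** * Cauchy-Schwarz and orthogonal projection *)

Lemma ipC u v : ip u v = Num.conj (ip v u).
Proof. by rewrite hermC expr0 mul1r. Qed.

(** Pythagoras: the remainder is orthogonal to [v]. *)
Lemma normB_component u v : v != 0 ->
  `|u - (ip u v / ip v v) *: v| ^+ 2 = `|u| ^+ 2 - `|ip u v| ^+ 2 / `|v| ^+ 2.
Proof.
move=> v0; have vv0 : ip v v != 0 by rewrite H_norm expf_neq0// normr_eq0.
rewrite -!H_norm dnormB/= dnormZ linearZr_LR/=.
set d := ip u v; set n := ip v v.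
have n_real : n \is Num.real by rewrite /n H_norm realX// normr_real.
have -> : Num.conj (d / n) * d = `|d| ^+ 2 / n.
  by rewrite rmorphM fmorphV/= (CrealP n_real) normCK mulrC mulrA.
have -> : Num.conj (`|d| ^+ 2 / n) = `|d| ^+ 2 / n.
  by apply/CrealP; rewrite realM// ?realV// realX// normr_real.
rewrite normf_div expr_div_n (real_normK n_real).
by field.
Qed.

Lemma ip_le u v : `|ip u v| <= `|u| * `|v|.
Proof.
have [->|v0] := eqVneq v 0; first by rewrite linear0r !normr0 mulr0.
rewrite -ler_sqr ?nnegrE ?mulr_ge0// exprMn.
rewrite -ler_pdivrMr ?exprn_gt0 ?normr_gt0//.
by rewrite -subr_ge0 -normB_component// exprn_ge0.
Qed.

(* A vector of [M] almost minimizing the distance to [y]: removing from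
   [y - m] its component along [v] decreases the squared norm by
   |<y - m, v>|^2 / |v|^2, hence by at most e^2. *)
Lemma near_projection (M : set H) (y : H) (e : R) :
  M 0 -> (forall a u v, M u -> M v -> M (a *: u + v)) -> 0 < e ->
  exists2 m, M m & forall v, M v -> `|ip (y - m) v| <= e%:C * `|v|.
Proof.
move=> M0 Mlin e0; pose D := [set complex.Re `|y - m| ^+ 2 | m in M].
have D0 : lbound D 0 by move=> _ [m _ <-]; rewrite sqr_ge0.
have Dinf : has_inf D by split; [exists (complex.Re `|y - 0| ^+ 2), 0|exists 0].
have [_ [m Mm <-] m_min] := inf_adherent (exprn_gt0 2 e0) Dinf.
exists m => // v Mv; have [->|v0] := eqVneq v 0.
  by rewrite linear0r !normr0 mulr0.
pose t := ip (y - m) v / ip v v.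
have : complex.Re `|y - m| ^+ 2 < complex.Re `|y - m - t *: v| ^+ 2 + e ^+ 2.
  apply: (lt_le_trans m_min); rewrite lerD2r; apply: ge_inf; first by exists 0.
  by exists (t *: v + m); [exact: Mlin|rewrite opprD addrA addrAC].
rewrite -ltcR rmorphD !rmorphXn/= !Re_normK normB_component// => /ltW.
rewrite addrAC lerBrDr lerD2l => le_e.
rewrite -ler_sqr ?nnegrE ?normr_ge0 ?mulr_ge0 ?lecR ?(ltW e0)// exprMn.
by rewrite -ler_pdivrMr ?exprn_gt0 ?normr_gt0.
Qed.

Lemma closure_approx (M : set H) (y : H) (e : R[i]) :
  closure M y -> 0 < e -> exists2 m, M m & `|y - m| <= e.
Proof.
move=> /(_ (ball y e)) My e0; have [|m [Mm]] := My; first exact: nbhsx_ballx.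
by rewrite -ball_normE/= => /ltW; exists m.
Qed.

(** [M] need not be closed, so [p] is only found in its closure, as the limit of almost minimizing
    vectors [m n]. These form a Cauchy sequence: both residuals [y - m n] and [y - m k] are almost
    orthogonal to [m n - m k], which lies in [M]. *)
Lemma projection (M : set H) (y : H) :
  M 0 -> (forall a u v, M u -> M v -> M (a *: u + v)) ->
  exists2 p, closure M p & forall v, M v -> ip (y - p) v = 0.
Proof.
move=> M0 Mlin.
have /choice[m mP] : forall n : nat, exists m, M m /\
    forall v, M v -> `|ip (y - m) v| <= n.+1%:R^-1%:C * `|v|.
  move=> n; have [|m Mm mP] := near_projection M y n.+1%:R^-1 M0 Mlin _.
    by rewrite invr_gt0 ltr0n.
  by exists m.
have MB u v : M u -> M v -> M (u - v).
  by move=> Mu Mv; rewrite addrC -scaleN1r; exact: Mlin.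
have dist_m n k : `|m n - m k| <= (n.+1%:R^-1 + k.+1%:R^-1)%:C.
  have [->|nk] := eqVneq (m n) (m k).
    by rewrite subrr normr0 lecR addr_ge0// invr_ge0 ler0n.
  have nk0 : 0 < `|m n - m k| by rewrite normr_gt0 subr_eq0.
  (* Bound the squared distance, a difference of two small inner products, and cancel one factor. *)
  rewrite -(ler_pM2r nk0) -expr2 -H_norm.
  have -> : ip (m n - m k) (m n - m k) =
      ip (y - m k) (m n - m k) - ip (y - m n) (m n - m k).
    by rewrite -linearBl/=; congr (ip _ _); rewrite opprB [RHS]addrC subrKA.
  have Mnk := MB _ _ (mP n).1 (mP k).1.
  rewrite -[leLHS]ger0_norm.
    apply: (le_trans (ler_normB _ _)).
    by rewrite rmorphD mulrDl addrC lerD// (mP _).2.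
  by rewrite -linearBl/= opprB addrC subrKA H_norm exprn_ge0.
(* In the order of [R[i]], a positive [e] is real. *)
have natS_small (e : R[i]) : 0 < e ->
    \forall n \near \oo, (n.+1%:R^-1 : R)%:C < e.
  move=> e0; have eE : e = (complex.Re e)%:C by rewrite RRe_real// gtr0_real.
  have e0' : 0 < complex.Re e by rewrite -ltcR -eE.
  near=> n; rewrite eE ltcR.
  by near: n; exact: (near_infty_natSinv_lt (PosNum e0')).
have : cvg (m @ \oo).
  apply: cauchy_cvg; apply: cauchy_exP => e e0.
  have e2 : 0 < e / 2 by rewrite divr_gt0.
  have [N _ NP] := natS_small _ e2.
  exists (m N); change (\forall n \near \oo, ball (m N) e (m n)).
  near=> n; rewrite -ball_normE/=.
  apply: (le_lt_trans (dist_m _ _)); rewrite rmorphD [ltRHS]splitr.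
  by apply: ltrD; [exact: (NP N (leqnn N))|near: n; exact: natS_small].
move=> m_cvg; exists (lim (m @ \oo)).
  move=> B /m_cvg[N _ NB]; exists (m N); split; first exact: (mP N).1.
  exact: (NB N (leqnn N)).
move=> v Mv; apply/eqP; rewrite -normr_le0.
have [->|v0] := eqVneq v 0; first by rewrite linear0r normr0.
have nv0 : 0 < `|v| by rewrite normr_gt0.
apply/ler_addgt0Pr => e e0; rewrite add0r.
have e2 : 0 < e / 2 / `|v| by rewrite !divr_gt0.
near \oo => n.
rewrite -(subrKA (m n)) linearDl/= [e]splitr.
apply: (le_trans (ler_normD _ _)); apply: lerD.
  apply: (le_trans ((mP n).2 _ Mv)); rewrite -ler_pdivlMr//.
  by apply: ltW; near: n; exact: natS_small.
apply: (le_trans (ip_le _ _)); rewrite -ler_pdivlMr//.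
near: n; exact: cvgr_distC_le.
Unshelve. all: by end_near. Qed.

(** * Riesz representation and the adjoint *)

(** If [f y] is nonzero, the residual [q] of [y] projected on the kernel of [f] is orthogonal to
    that kernel, which contains [x - (f x / f q) *: q] for every [x]. *)
Lemma riesz (f : H -> R[i]) (C : R[i]) :
  (forall a u v, f (a *: u + v) = a * f u + f v) ->
  (forall x, `|f x| <= C * `|x|) -> exists z, forall x, f x = ip x z.
Proof.
move=> flin fC.
have f0 : f 0 = 0.
  by have := flin (-1) 0 0; rewrite scaler0 addr0 mulN1r addNr.
have fB u v : f (u - v) = f u - f v.
  by rewrite addrC -scaleN1r flin mulN1r addrC.
(* [C] may be any complex number, hence the passage to its modulus. *)
have fnC x : `|f x| <= `|C| * `|x|.
  apply: (le_trans (fC x)).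
  by rewrite -[leLHS]ger0_norm ?(le_trans _ (fC x))// normrM normr_id.
have [fzero|/existsNP[y /eqP fy0]] := pselect (forall x, f x = 0).
  by exists 0 => x; rewrite fzero linear0r.
have [|p ker_p p_orth] := projection [set x | f x = 0] y f0.
  by move=> a u v /= fu fv; rewrite flin fu fv mulr0 addr0.
(* The kernel is closed since [f] is bounded; the [+ 1] keeps the denominator positive. *)
have fp0 : f p = 0.
  apply/eqP; rewrite -normr_le0; apply/ler_addgt0Pr => e e0; rewrite add0r.
  have C1 : 0 < `|C| + 1 by rewrite ltr_wpDl.
  have [|m /= fm pm] := closure_approx _ _ (e / (`|C| + 1)) ker_p.
    by rewrite divr_gt0.
  rewrite -[f p]subr0 -fm -fB; apply: (le_trans (fnC _)).
  have: (`|C| + 1) * `|p - m| <= e by rewrite mulrC -ler_pdivlMr.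
  by apply: le_trans; rewrite ler_wpM2r// lerDl.
pose q := y - p.
have fq : f q = f y by rewrite fB fp0 subr0.
have qq0 : ip q q != 0.
  rewrite H_norm expf_neq0// normr_eq0.
  by apply: contraNneq fy0 => q0; rewrite -fq q0 f0.
(* The conjugate compensates conjugate-linearity in the second argument. *)
exists (Num.conj (f q / ip q q) *: q) => x.
rewrite linearZr_LR/= conjCK.
have : ip q (x - (f x / f q) *: q) = 0.
  apply: p_orth => /=; rewrite fB -[_ *: q]addr0 flin f0 addr0 divfK ?subrr//.
  by rewrite fq.
move/(congr1 Num.conj); rewrite -ipC rmorph0 linearBl linearZl_LR/= => /eqP.
rewrite subr_eq0 => /eqP ->.
by field; rewrite fq fy0 qq0.
Qed.

Lemma adjointP (T : {linear H -> H}) : bounded_operator T ->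
  forall x y, ip (T x) y = ip x (adjoint ip T y).
Proof.
move=> [C TC] x y; rewrite /adjoint.
apply: (xgetPex 0 (P := [set z | forall x, ip (T x) y = ip x z])) x.
apply: (riesz _ (C * `|y|)) => [a u v|x].
  by rewrite linearP linearDl linearZl_LR.
by apply: (le_trans (ip_le _ _)); rewrite mulrAC ler_wpM2r.
Qed.

Lemma adjoint_linear (T : {linear H -> H}) : bounded_operator T ->
  linear (adjoint ip T).
Proof.
move=> /adjointP adjT a u v; apply/eqP; rewrite -subr_eq0 -(dnorm_eq0 ip).
by rewrite linearBr linearPr/= -!adjT linearPr/= subrr.
Qed.

(** * Minimum modulus *)

Lemma min_modulus_ge0 (A : H -> H) : 0 <= min_modulus A.
Proof.
rewrite /min_modulus; set E := (X in inf X).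
(* Without unit vectors, the infimum is 0 by convention. *)
have [->|/set0P E0] := eqVneq E set0; first by rewrite inf0.
apply: lb_le_inf => [//|_ [x _ <-]]; exact: Re_norm_ge0.
Qed.

Lemma min_modulus_mul_le (A : {linear H -> H}) (x : H) :
  (min_modulus A)%:C * `|x| <= `|A x|.
Proof.
have [->|x0] := eqVneq x 0; first by rewrite normr0 mulr0.
have nx0 : 0 < `|x| by rewrite normr_gt0.
have nVx : `| `|x|^-1 | = `|x|^-1 by rewrite ger0_norm// invr_ge0.
rewrite -ler_pdivlMr// mulrC -nVx -normrZ -linearZ -Re_normK lecR.
apply: ge_inf; first by exists 0 => _ [z _ <-]; exact: Re_norm_ge0.
exists (`|x|^-1 *: x) => //=.
by rewrite normrZ nVx mulVf// gt_eqF.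
Qed.

Lemma min_modulus_eq0 (A : {linear H -> H}) (x : H) :
  x != 0 -> A x = 0 -> min_modulus A = 0.
Proof.
move=> x0 Ax; apply/eqP; rewrite eq_le min_modulus_ge0 andbT.
have := min_modulus_mul_le A x; rewrite Ax normr0 pmulr_lle0 ?normr_gt0//.
by rewrite lecR.
Qed.

(** The orthogonal complement of the range of [A] is the kernel of [B], so injectivity of [B] makes
    that range dense. *)
Lemma min_modulus_le_adjoint (A : {linear H -> H}) (B : H -> H) :
  (forall x y, ip (A x) y = ip x (B y)) -> (forall y, B y = 0 -> y = 0) ->
  min_modulus A <= min_modulus B.
Proof.
move=> AB B_inj; set c := min_modulus A.
rewrite [leRHS]/min_modulus; set E := [set x : H | `|x| = 1].
have [E0|/set0P E0] := eqVneq E set0.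
  by rewrite /c /min_modulus -/E E0 !image_set0.
apply: lb_le_inf; first exact: image_nonempty.
move=> _ [y /= y1 <-]; rewrite -lecR Re_normK.
have c0 : 0 <= c%:C by rewrite lecR min_modulus_ge0.
have [||p ran_p p_orth] := projection (range A) y.
- by exists 0; rewrite ?linear0.
- by move=> a _ _ [u _ <-] [v _ <-]; exists (a *: u + v); rewrite ?linearP.
(* [B (y - p)] vanishes: its squared norm is the inner product of [A (B (y - p))] with [y - p],
   which is orthogonal to the range. *)
have yp : y = p.
  apply/eqP; rewrite -subr_eq0; apply/eqP; apply: B_inj; apply/eqP.
  rewrite -(dnorm_eq0 ip) -AB; apply/eqP.
  by rewrite ipC p_orth ?rmorph0//; exists (B (y - p)).
apply/ler_addgt0Pr => e e0.
(* With tolerance [d], the total error will be [d * (|B y| + c)]; the [+ 1] ensures a nonzero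
   divisor. *)
have d0 : 0 < `|B y| + c%:C + 1 by rewrite ltr_wpDl// addr_ge0.
have [|_ [x _ <-] yAx] := closure_approx _ _ (e / (`|B y| + c%:C + 1)) ran_p.
  by rewrite divr_gt0.
set d := e / _ in yAx; rewrite -yp in yAx.
have cx : c%:C * `|x| <= 1 + d.
  apply: (le_trans (min_modulus_mul_le A x)).
  rewrite -(subKr y (A x)); apply: (le_trans (ler_normB _ _)).
  by rewrite y1 lerD2l.
(* Split the first [y] as [A x + (y - A x)] and move [A] across as [B]. *)
have : c%:C * ip y y <= (1 + d) * `|B y| + c%:C * d.
  have -> : ip y y = `|ip (A x) y + ip (y - A x) y|.
    by rewrite -linearDl/= addrC subrK ger0_norm// H_norm exprn_ge0.
  apply: (le_trans (ler_wpM2l c0 (ler_normD _ _))); rewrite mulrDr lerD//.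
    rewrite AB; apply: (le_trans (ler_wpM2l c0 (ip_le _ _))).
    by rewrite mulrA ler_wpM2r.
  rewrite ler_wpM2l//; apply: (le_trans (ip_le _ _)).
  by rewrite y1 mulr1.
rewrite H_norm y1 expr1n mulr1 => /le_trans; apply.
rewrite mulrDl mul1r -addrA lerD2l [c%:C * d]mulrC -mulrDr.
rewrite /d mulrAC ler_pdivrMr// ler_wpM2l ?ltW//.
by rewrite ltrDl.
Qed.

(** * Dimension zero *)

Lemma orthonormal_basis_set0 (E : set H) :
  orthonormal_basis ip [set 0] E -> E = set0.
Proof.
move=> [E_on E0]; apply/seteqP; split=> // e Ee.
have : closure (lin_span E) e.
  apply: subset_closure; exists 1, (fun=> 1), (fun=> e); split=> //.
  by rewrite big_ord1 scale1r.
rewrite E0/= => e0; have := E_on e e Ee Ee; rewrite e0 linear0r eqxx.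
by move/eqP; rewrite eq_sym oner_eq0.
Qed.

Lemma lin_span_set0 : lin_span (@set0 H) = [set 0].
Proof.
apply/seteqP; split=> x /=.
  by move=> [[|n] [c [e [Ee ->]]]]; [rewrite big_ord0|case: (Ee ord0)].
by move=> ->; exists 0, (fun=> 0), (fun=> 0); split=> [[]//|]; rewrite big_ord0.
Qed.

Lemma same_dim_sym (M N : set H) : same_dim ip M N -> same_dim ip N M.
Proof.
by move=> [E [F [ME NF EF]]]; exists F, E; split; rewrite // card_esym.
Qed.

(** Both bases are empty, and the closed span of the empty set is the closure of a point. *)
Lemma same_dim_set0 (N : set H) : same_dim ip [set 0] N -> N = [set 0].
Proof.
move=> [E [F [/orthonormal_basis_set0 -> [_ <-]]]].
rewrite card_eq_sym card_eq0 => /eqP ->; rewrite lin_span_set0.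
apply/esym/closure_id; apply: accessible_closed_set1.
by apply: hausdorff_accessible; exact: norm_hausdorff.
Qed.

End Hilbert.

Theorem theorem3p2 (R : realType) (H : completeNormedModType R[i])
    (ip : {dot H for @Num.conj R[i]}) (H_norm : induces_norm ip)
    (H_infdim : infinite_dimensional H) (H_sep : separable_space H)
    (T : {linear H -> H}) (T_bounded : bounded_operator T)
    (dimN : same_dim ip (null_space T) (null_space (adjoint ip T))) :
  min_modulus T = min_modulus (adjoint ip T).
Proof.
have adjT := adjointP _ _ _ H_norm T T_bounded.
(* Bundling the adjoint with its linearity lets the lemmas apply to [T] and its adjoint alike. *)
pose T' : {linear H -> H} := HB.pack (adjoint ip T)
  (GRing.isLinear.Build _ _ _ _ _ (adjoint_linear _ _ _ H_norm T T_bounded)).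
rewrite -[adjoint ip T]/(T' : H -> H) in dimN adjT *.
have null0 (A : {linear H -> H}) : null_space A 0 by exact: linear0.
have null_trivial (A : {linear H -> H}) :
    ~ (exists2 x, x != 0 & A x = 0) -> null_space A = [set 0].
  move=> A_inj; apply/seteqP; split=> [x Ax|x ->]; last exact: null0.
  by apply/eqP; apply: contra_notT A_inj => x0; exists x.
have [[x x0 Tx]|T_inj] := pselect (exists2 x, x != 0 & T x = 0);
    have [[y y0 T'y]|T'_inj] := pselect (exists2 y, y != 0 & T' y = 0).
- by rewrite (min_modulus_eq0 _ _ _ _ x0 Tx) (min_modulus_eq0 _ _ _ _ y0 T'y).
(* The two mixed cases contradict the equality of dimensions. *)
- move: dimN; rewrite (null_trivial _ T'_inj).
  move=> /same_dim_sym /(same_dim_set0 _ _ _ _) Nx.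
  have : null_space T x by [].
  by rewrite Nx/= => /eqP; rewrite (negbTE x0).
- move: dimN; rewrite (null_trivial _ T_inj) => /same_dim_set0 Ny.
  have : null_space T' y by [].
  by rewrite Ny/= => /eqP; rewrite (negbTE y0).
apply/eqP; rewrite eq_le; apply/andP; split.
  apply: (min_modulus_le_adjoint _ _ _ H_norm) => // y T'y.
  by apply/eqP; apply: contra_notT T'_inj => y0; exists y.
(* Conjugating the adjoint relation exchanges the roles of [T] and [T']. *)
apply: (min_modulus_le_adjoint _ _ _ H_norm) => [x y|x Tx].
  by rewrite ipC -adjT -ipC.
by apply/eqP; apply: contra_notT T_inj => x0; exists x.
Qed.
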